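(* Let $\Phi:\mathbb{M}_n\to\mathbb{M}_l$ and $\Psi:\mathbb{M}_m\to\mathbb{M}_l$ be positive linear maps. Let $p_0,p_1\in[0,\infty)$ and $0\le\alpha\le1$, and let $p_\alpha:=(1-\alpha)p_0+\alpha p_1$. Then for every $A\in\mathbb{M}_n^+$ and $B\in\mathbb{M}_m^+$, $$\lambda\bigl(\Phi(A^{p_\alpha})^{1/2}\Psi(B^{p_\alpha})\Phi(A^{p_\alpha})^{1/2}\bigr)\prec_{w(\log)}\lambda^{1-\alpha}\bigl(\Phi(A^{p_0})^{1/2}\Psi(B^{p_0})\Phi(A^{p_0})^{1/2}\bigr)\,\lambda^\alpha\bigl(\Phi(A^{p_1})^{1/2}\Psi(B^{p_1})\Phi(A^{p_1})^{1/2}\bigr),$$ or equivalently, $$s\bigl(\Phi(A^{p_\alpha})^{1/2}\Psi(B^{p_\alpha})^{1/2}\bigr)\prec_{w(\log)}s^{1-\alpha}\bigl(\Phi(A^{p_0})^{1/2}\Psi(B^{p_0})^{1/2}\bigr)\,s^\alpha\bigl(\Phi(A^{p_1})^{1/2}\Psi(B^{p_1})^{1/2}\bigr).$$ In particular, for every $A,B\in\mathbb{M}_n^+$, $$s(A^{p_\alpha}B^{p_\alpha})\prec_{(\log)}s^{1-\alpha}(A^{p_0}B^{p_0})\,s^\alpha(A^{p_1}B^{p_1}).$$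
   Context: $\mathbb{M}_n$ is the algebra of $n\times n$ complex matrices and $\mathbb{M}_n^+$ the set of positive semidefinite matrices in $\mathbb{M}_n$. A linear map $\Phi:\mathbb{M}_n\to\mathbb{M}_l$ is positive if $\Phi(A)\in\mathbb{M}_l^+$ for all $A\in\mathbb{M}_n^+$. Powers of positive semidefinite matrices are defined by functional calculus, with the convention $0^0:=1$ (so $A^0=I$); the same convention is used for powers of non-negative numbers. For $X\in\mathbb{M}_l^+$, $\lambda(X)=(\lambda_1(X),\dots,\lambda_l(X))$ is the vector of eigenvalues of $X$ in decreasing order with multiplicities; for any $X\in\mathbb{M}_l$, $s(X)=(s_1(X),\dots,s_l(X))$ is the vector of singular values of $X$ in decreasing order with multiplicities. Powers and products of such vectors are entrywise: $\lambda^{t}(X)=(\lambda_1(X)^{t},\dots,\lambda_l(X)^{t})$, $\lambda^{t}(X)\lambda^{u}(Y)=(\lambda_i(X)^t\lambda_i(Y)^u)_i$, and likewise for $s$. For non-negative decreasing vectors $a=(a_1\ge\dots\ge a_n\ge0)$ and $b=(b_1\ge\dots\ge b_n\ge0)$, $a\prec_{w(\log)}b$ means $\prod_{i=1}^ka_i\le\prod_{i=1}^kb_i$ for all $1\le k\le n$; $a\prec_{(\log)}b$ means $a\prec_{w(\log)}b$ with equality for $k=n$. *)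

(* Defs.v *)
From mathcomp Require Import all_boot all_order all_algebra.
From mathcomp Require Import sesquilinear spectral.
From mathcomp Require Import complex.
From mathcomp Require Import reals exp.

Set Implicit Arguments.
Unset Strict Implicit.
Unset Printing Implicit Defensive.

Import Order.TTheory GRing.Theory Num.Theory.

Local Open Scope ring_scope.
Local Open Scope complex_scope.
Local Open Scope sesquilinear_scope.

Section Definitions.
Context {R : realType}.
Implicit Types m n l : nat.

Definition psdmx n (A : 'M[R[i]]_n) : Prop :=
  A ^t* = A /\ forall x : 'cV[R[i]]_n, 0 <= (x ^t* *m A *m x) 0 0.

Definition positive_map n l (Phi : 'M[R[i]]_n -> 'M[R[i]]_l) : Prop :=
  forall A, psdmx A -> psdmx (Phi A).

(* Functional calculus for the function t |-> t `^ p in the spectral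
   decomposition A = U^* D U, where U = spectralmx A is unitary and D is the
   diagonal matrix of spectral_diag A.  The eigenvalues are real when A is
   Hermitian, so that taking real parts is harmless; the value is meaningful
   only for A positive semidefinite.  As 0 `^ 0 = 1, A to the 0 is 1%:M. *)
Definition mxpowR n (A : 'M[R[i]]_n) (p : R) : 'M[R[i]]_n :=
  (spectralmx A) ^t*
    *m diag_mx (map_mx (fun z => (powR (complex.Re z) p)%:C) (spectral_diag A))
    *m spectralmx A.

(* Meaningful for X Hermitian; see char_poly_eigvals below. *)
Definition eigvals n (X : 'M[R[i]]_n) : 'rV[R]_n :=
  \row_(i < n)
    (sort >=%R [seq complex.Re (spectral_diag X 0 j) | j <- enum 'I_n])`_i.

(* The eigenvalues of |X| = (X^* X)^(1/2). *)
Definition singvals n (X : 'M[R[i]]_n) : 'rV[R]_n :=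
  eigvals (mxpowR (X ^t* *m X) 2^-1).

Definition vpowR n (a : 'rV[R]_n) (t : R) : 'rV[R]_n :=
  map_mx (fun x => powR x t) a.

Definition vmul n (a b : 'rV[R]_n) : 'rV[R]_n := map2_mx *%R a b.

(* Only used for non-negative decreasing vectors. *)
Definition wlog_major n (a b : 'rV[R]_n) : Prop :=
  forall k : nat, (1 <= k <= n)%N ->
    \prod_(i < n | (i < k)%N) a 0 i <= \prod_(i < n | (i < k)%N) b 0 i.

Definition log_major n (a b : 'rV[R]_n) : Prop :=
  wlog_major a b /\ \prod_(i < n) a 0 i = \prod_(i < n) b 0 i.

End Definitions.

Notation "A ^^ p" := (mxpowR A p) (at level 29, left associativity) :
  ring_scope.

Lemma eigvals_sorted (R : realType) n (X : 'M[R[i]]_n) (i j : 'I_n) :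
  (i <= j)%N -> eigvals X 0 j <= eigvals X 0 i.
Proof.
move=> ij; rewrite !mxE.
set s := sort _ _.
have szs : size s = n by rewrite size_sort size_map size_enum_ord.
have ss : sorted >=%R s by apply: sort_sorted => x y; exact: le_total.
have ge_tr : transitive (>=%R : rel R) by move=> x y z yx xz; exact: le_trans yx.
by apply: (sorted_leq_nth ge_tr (@lexx _ R) 0 ss) => //; rewrite inE szs.
Qed.

Lemma char_poly_eigvals (R : realType) n (X : 'M[R[i]]_n) :
  X ^t* = X -> char_poly X = \prod_(i < n) ('X - ((eigvals X 0 i)%:C)%:P).
Proof.
move=> hX.
have hermX : X \is hermsymmx.
  by apply/is_hermitianmxP; rewrite expr0 scale1r hX.
have /mxOverP realD := hermitian_spectral_diag_real hermX.
have /orthomx_spectralP XE := hermitian_normalmx hermX.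
set P := spectralmx X in XE; set d := spectral_diag X in XE realD.
have Pu : P \in unitmx := spectral_unit X.
have -> : char_poly X = char_poly (diag_mx d).
  rewrite /char_poly; set f := @polyC R[i].
  have PV : map_mx f (invmx P) *m map_mx f P = 1%:M.
    by rewrite -map_mxM mulVmx // map_mx1.
  have -> : char_poly_mx X
          = map_mx f (invmx P) *m char_poly_mx (diag_mx d) *m map_mx f P.
    rewrite /char_poly_mx mulmxBr mulmxBl -!map_mxM -XE; congr (_ - _).
    by rewrite scalar_mxC -mulmxA PV mulmx1.
  by rewrite !det_mulmx mulrAC -det_mulmx PV det1 mul1r.
rewrite char_poly_trig ?diag_mx_is_trig //.
pose F (x : R) : {poly R[i]} := 'X - (x%:C)%:P.
transitivity (\prod_(x <- [seq complex.Re (d 0 j) | j <- enum 'I_n]) F x).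
  rewrite big_map big_enum /=; apply: eq_bigr => i _.
  by rewrite /F mxE eqxx mulr1n RRe_real.
rewrite -(perm_big _ (permEl (perm_sort >=%R _))) /=.
rewrite (big_nth 0) size_sort size_map size_enum_ord big_mkord.
by apply: eq_bigr => i _; rewrite mxE.
Qed.

(* Main.v *)
Require Import Defs.
From mathcomp Require Import all_boot all_order all_algebra all_fingroup.
From mathcomp Require Import sesquilinear spectral.
From mathcomp Require Import complex.
From mathcomp Require Import reals exp.
From mathcomp Require Import lra.

(* With the spectral projections P_i of A, each Phi(P_i) = C_i^* C_i; stacking
   the C_i with weights a_i^(q/2) gives matrices G_q such that
   Phi(A^((q+r)/2)) = G_q^* G_r, and likewise Psi(B^((q+r)/2)) = F_r^* F_q.
   Hence Phi(A^s) Psi(B^s), for s = (q+r)/2, has up to zeros the eigenvalues of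
   (F_q G_q^* ) (G_r F_r^* ), and by the inequalities of Weyl and Horn the
   product g(s) of its k largest eigenvalues satisfies g(s)^2 <= g(q) g(r).
   A bounded function which is log-convex at midpoints is log-convex, so this
   is the theorem.

   Weyl and Horn are read off from the bound
   det(V^* H V) <= (product of the k largest eigenvalues of H) det(V^* V), a
   consequence of the Cauchy-Binet formula. *)

Set Implicit Arguments.
Unset Strict Implicit.
Unset Printing Implicit Defensive.

Import Order.TTheory GRing.Theory Num.Theory.

Local Open Scope ring_scope.

(** * Determinantal inequalities *)

Section CauchyBinet.
Variables (F : comNzRingType) (k n : nat).
Implicit Types (A : 'M[F]_(k, n)) (B : 'M[F]_(n, k)) (f : {ffun 'I_k -> 'I_n}).

Lemma det_mulmx_expand A B :
  \det (A *m B) =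
  \sum_(f : {ffun 'I_k -> 'I_n}) (\prod_i A i (f i)) * \det (rowsub f B).
Proof.
pose AB (s : 'S_k) i j := A i j * B j (s i).
transitivity (\sum_(f : {ffun 'I_k -> 'I_n})
    \sum_(s : 'S_k) (-1) ^+ s * \prod_i AB s i (f i)).
  rewrite exchange_big; apply: eq_bigr => /= s _; rewrite -big_distrr /=.
  congr (_ * _); rewrite -(bigA_distr_bigA (AB s)) /=.
  by apply: eq_bigr => x _; rewrite mxE.
apply: eq_bigr => f _; rewrite big_distrr; apply: eq_bigr => s _ /=.
rewrite big_split /= mulrCA; congr (_ * (_ * _)).
by apply: eq_bigr => i _; rewrite mxE.
Qed.

(* Summing over all maps [f] rather than over subsets counts each minor
   [k`!] times. *)
Lemma cauchy_binet A B :
  (k`!)%:R * \det (A *m B) =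
  \sum_(f : {ffun 'I_k -> 'I_n}) \det (colsub f A) * \det (rowsub f B).
Proof.
(* Relabelling the row choices by [s] permutes the rows of the minor of [B] and brings out the sign
   of [s]; summing over all [s] then assembles the minors of [A]. *)
have perm_expand (s : 'S_k) : \det (A *m B) =
    \sum_(f : {ffun 'I_k -> 'I_n})
      (-1) ^+ s * (\prod_i A i (f (s i))) * \det (rowsub f B).
  rewrite det_mulmx_expand.
  pose h (s' : 'S_k) f := [ffun i => f (s' i)].
  rewrite (reindex (h s)) /=; last first.
    exists (h (s^-1)%g) => f _; apply/ffunP=> i; rewrite !ffunE.
      by rewrite permKV.
    by rewrite permK.
  apply: eq_bigr => f _.
  have -> : rowsub (h s f) B = row_perm s (rowsub f B).
    by apply/matrixP=> i j; rewrite !mxE ffunE.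
  rewrite row_permE det_mulmx det_perm mulrCA mulrA; congr (_ * _ * _).
  by apply: eq_bigr => i _; rewrite ffunE.
have -> : (k`!)%:R * \det (A *m B) = \sum_(s : 'S_k) \det (A *m B).
  by rewrite sumr_const card_Sn mulr_natl.
under eq_bigr => s _ do rewrite (perm_expand s).
rewrite exchange_big; apply: eq_bigr => f _ /=.
rewrite -big_distrl -det_tr; congr (_ * _); apply: eq_bigr => s _.
by congr (_ * _); apply: eq_bigr => i _; rewrite !mxE.
Qed.

End CauchyBinet.

(** The image of [f] and the first [k] indices are equally many. Once their common part is
    cancelled, the indices left in the image are at least [k], so each factor left there is at most
    each factor left on the right. *)
Lemma prod_inj_le (R : realDomainType) n k (d : 'I_n -> R)
    (f : 'I_k -> 'I_n) :
  (forall i, 0 <= d i) -> (forall i j : 'I_n, (i <= j)%N -> d j <= d i) ->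
  injective f -> \prod_i d (f i) <= \prod_(i < n | (i < k)%N) d i.
Proof.
move=> d0 dmon finj.
have le_kn : (k <= n)%N by have := leq_card f finj; rewrite !card_ord.
pose S := [set f i | i : 'I_k]; pose T := [set i : 'I_n | (i < k)%N].
have -> : \prod_i d (f i) = \prod_(j in S) d j.
  by rewrite /S big_imset //=; apply: in2W.
have -> : \prod_(i < n | (i < k)%N) d i = \prod_(j in T) d j.
  by apply: eq_bigl => i; rewrite inE.
have cST : #|S :\: T| = #|T :\: S|.
  have cS : #|S| = k by rewrite card_imset // card_ord.
  have cT : #|T| = k.
    rewrite cardsE -sum1_card (big_ord_narrow le_kn) /=.
    by rewrite sum1_card card_ord.
  by apply/eqP; rewrite -(eqn_add2l #|S :&: T|) cardsID setIC cardsID cT cS.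
rewrite (big_setID T) [leRHS](big_setID S) /= [T :&: S]setIC.
apply: ler_wpM2l; first by apply: prodr_ge0 => i _.
case: k f finj le_kn @S @T cST => [|k] f finj le_kn S T cST.
  have T0 : T = set0 by apply/setP=> i; rewrite !inE.
  by move: cST; rewrite T0 set0D cards0 => /cards0_eq ->; rewrite !big_set0.
(* There are now [k.+1] factors, so [i0] is the last index in [T] and [d i0] separates the two
   products. *)
pose i0 := Ordinal le_kn.
apply: (@le_trans _ _ (\prod_(j in S :\: T) d i0)).
  apply: ler_prod => i; rewrite !inE -leqNgt => /andP[ki _]; rewrite d0 /=.
  by apply: dmon; exact: ltnW.
rewrite prodr_const cST -prodr_const; apply: ler_prod => i.
by rewrite !inE => /andP[_ ik]; rewrite d0 dmon.
Qed.

Section DetBound.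
Local Open Scope sesquilinear_scope.
Variable C : numClosedFieldType.

Lemma trmxC_mul m n p (A : 'M[C]_(m, n)) (B : 'M[C]_(n, p)) :
  (A *m B) ^t* = B ^t* *m A ^t*.
Proof. by rewrite trmx_mul map_mxM. Qed.

Lemma det_trmxC n (A : 'M[C]_n) : \det (A ^t*) = (\det A)^*.
Proof. by rewrite det_map_mx det_tr. Qed.

Lemma trmxC_diag_mx n (d : 'rV[C]_n) :
  (diag_mx d) ^t* = diag_mx (map_mx Num.conj d).
Proof. by rewrite tr_diag_mx map_diag_mx. Qed.

Lemma det_colsub_trmxC n k (A : 'M[C]_(n, k)) (f : 'I_k -> 'I_n) :
  \det (colsub f (A ^t*)) = (\det (rowsub f A))^*.
Proof. by rewrite -det_trmxC -map_mxsub trmx_mxsub. Qed.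

Lemma fact_gt0C k : 0 < (k`!)%:R :> C.
Proof. by rewrite ltr0n fact_gt0. Qed.

Lemma det_gram_ge0 n k (V : 'M[C]_(n, k)) : 0 <= \det (V ^t* *m V).
Proof.
rewrite -(pmulr_rge0 _ (fact_gt0C k)) cauchy_binet; apply: sumr_ge0 => f _.
by rewrite det_colsub_trmxC mulrC mul_conjC_ge0.
Qed.

(** By Cauchy-Binet these determinants are, up to a factorial, inner products of the vectors [r A]
    and [r B] of minors of order [k], to which the usual Cauchy-Schwarz inequality applies. *)
Lemma det_gram_CauchySchwarz n k (A B : 'M[C]_(n, k)) :
  `|\det (A ^t* *m B)| ^+ 2 <= \det (A ^t* *m A) * \det (B ^t* *m B).
Proof.
pose I : finType := {ffun 'I_k -> 'I_n}.
pose r (V : 'M[C]_(n, k)) : 'rV[C]_#|I| :=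
  \row_j \det (rowsub (enum_val j : I) V).
have E (U V : 'M[C]_(n, k)) : (k`!)%:R * \det (U ^t* *m V) = dotmx (r V) (r U).
  rewrite cauchy_binet dotmxE mxE (reindex (@enum_val I predT)) /=; last first.
    exact/onW_bij/enum_val_bij.
  by apply: eq_bigr => j _; rewrite !mxE det_colsub_trmxC mulrC.
have : `|dotmx (r B) (r A)| ^+ 2 <= dotmx (r B) (r B) * dotmx (r A) (r A).
  exact: (CauchySchwarz (@dotmx C #|I|) (r B) (r A)).1.
rewrite -!E normrM; have f0 := fact_gt0C k; rewrite (ger0_norm (ltW f0)) exprMn.
rewrite [leRHS]mulrACA -[X in _ <= X * _]expr2 ler_pM2l ?exprn_gt0 //.
by rewrite [leRHS]mulrC.
Qed.

(** A Rayleigh quotient bound in the [k]-th exterior power, tested on decomposable vectors: the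
    wedge of the columns of [V]. *)
Definition det_bound n k (H : 'M[C]_n) (c : C) :=
  forall V : 'M[C]_(n, k), \det (V ^t* *m H *m V) <= c * \det (V ^t* *m V).

(** Cauchy-Binet turns both sides into sums over [f] of squared moduli of minors of [V], with weight
    the product of the [d 0 (f i)] on the left and [c] on the right. A non-injective [f] repeats a
    row, so its minor vanishes. *)
Lemma det_bound_diag n k (d : 'rV[C]_n) (c : C) :
  (forall f : 'I_k -> 'I_n, injective f -> \prod_i d 0 (f i) <= c) ->
  det_bound k (diag_mx d) c.
Proof.
move=> dc V; have f0 := fact_gt0C k.
rewrite -(ler_pM2l f0) mulrCA -mulmxA !cauchy_binet big_distrr /=.
apply: ler_sum => f _; rewrite det_colsub_trmxC.
have -> : rowsub f (diag_mx d *m V) =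
    diag_mx (\row_i d 0 (f i)) *m rowsub f V.
  by apply/matrixP=> i j; rewrite !mul_diag_mx !mxE.
rewrite det_mulmx det_diag mulrCA.
under eq_bigr => i _ do rewrite mxE.
have [/injectiveP finj|/injectivePn [i [j ij fij]]] := boolP (injectiveb f).
  by rewrite ler_wpM2r ?dc // mulrC mul_conjC_ge0.
rewrite (determinant_alternate ij) ?mulr0 //.
by move=> x; rewrite !mxE fij.
Qed.

(** Cauchy-Schwarz for [V] and [M ^t* *m M *m V] bounds [d1 ^+ 2] by [d0] times a determinant which
    the hypothesis, applied to [M *m V], bounds by [c * d1]. One factor [d1] then cancels. *)
Lemma det_bound_swap m n k (M : 'M[C]_(m, n)) (c : C) : 0 <= c ->
  det_bound k (M *m M ^t*) c -> det_bound k (M ^t* *m M) c.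
Proof.
move=> c0 bM V; set d0 := \det (V ^t* *m V).
set d1 := \det _.
have d0_ge0 : 0 <= d0 := det_gram_ge0 _.
have d1E : d1 = \det ((M *m V) ^t* *m (M *m V)).
  by rewrite /d1 trmxC_mul !mulmxA.
have d1_ge0 : 0 <= d1 by rewrite d1E det_gram_ge0.
have := bM (M *m V); rewrite -d1E => b1.
have := det_gram_CauchySchwarz V (M ^t* *m M *m V).
have -> : \det (V ^t* *m (M ^t* *m M *m V)) = d1 by rewrite /d1 !mulmxA.
rewrite [X in _ <= _ * X](_ : _ =
    \det ((M *m V) ^t* *m (M *m M ^t*) *m (M *m V))).
  rewrite ger0_norm // => CS; have := le_trans CS (ler_wpM2l d0_ge0 b1).
  move: d1_ge0; rewrite le0r => /orP[/eqP-> _|d1_gt0]; first exact: mulr_ge0.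
  by rewrite mulrA expr2 ler_pM2r // mulrC.
by rewrite !trmxC_mul trmxCK !mulmxA.
Qed.

End DetBound.

(** * Spectral decomposition of positive semidefinite matrices *)

Section Spectrum.
Local Open Scope complex_scope.
Local Open Scope sesquilinear_scope.
Variable R : realType.
Implicit Types (n : nat) (p q : R).

(** At base zero the addition law fails when nonzero exponents cancel, as zero to the power zero is
    one; nonnegative exponents exclude this. *)
Lemma powRD_ge0 (x p q : R) : 0 <= p -> 0 <= q ->
  x `^ (p + q) = x `^ p * x `^ q.
Proof.
move=> p0 q0; have [pq0|pq0] := eqVneq (p + q) 0; last first.
  by rewrite powRD // (negbTE pq0).
have [-> ->] : p = 0 /\ q = 0 by lra.
by rewrite addr0 powRr0 mulr1.
Qed.

Lemma powR_prod (I : finType) (P : pred I) (f : I -> R) p :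
  (forall i, 0 <= f i) -> (\prod_(i | P i) f i) `^ p = \prod_(i | P i) f i `^ p.
Proof.
move=> f0; pose K (x y : R) := 0 <= x /\ x `^ p = y.
suff [] : K (\prod_(i | P i) f i) (\prod_(i | P i) f i `^ p) by [].
apply: (big_ind2 K) => [|x1 y1 x2 y2 [x1_ge0 <-] [x2_ge0 <-]|i _]; split => //.
- by rewrite powR1.
- exact: mulr_ge0.
- exact: powRM.
Qed.

Definition rdiag_mx n (d : 'rV[R]_n) : 'M[R[i]]_n :=
  diag_mx (map_mx (real_complex R) d).

Lemma rdiag_mxM n (d e : 'rV[R]_n) :
  rdiag_mx d *m rdiag_mx e = rdiag_mx (vmul d e).
Proof.
rewrite /rdiag_mx mulmx_diag; congr diag_mx.
by apply/rowP => i; rewrite !mxE rmorphM.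
Qed.

Lemma trmxC_rdiag_mx n (d : 'rV[R]_n) : (rdiag_mx d) ^t* = rdiag_mx d.
Proof.
rewrite trmxC_diag_mx; congr diag_mx; apply/rowP => i; rewrite !mxE.
exact: conjc_real.
Qed.

Definition conj_rdiag n (U : 'M[R[i]]_n) (d : 'rV[R]_n) : 'M[R[i]]_n :=
  U ^t* *m rdiag_mx d *m U.

Lemma trmxC_conj_rdiag n (U : 'M[R[i]]_n) (d : 'rV[R]_n) :
  (conj_rdiag U d) ^t* = conj_rdiag U d.
Proof.
by rewrite /conj_rdiag !trmxC_mul trmxC_rdiag_mx trmxCK mulmxA.
Qed.

Lemma trmxC_unitary_mul n (U : 'M[R[i]]_n) : U \is unitarymx ->
  U ^t* *m U = 1%:M.
Proof. by move=> Uu; rewrite -invmx_unitary // mulVmx ?unitarymx_unit. Qed.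

Lemma conj_rdiagM n (U : 'M[R[i]]_n) d e : U \is unitarymx ->
  conj_rdiag U d *m conj_rdiag U e = conj_rdiag U (vmul d e).
Proof.
move=> /unitarymxP Uu; rewrite /conj_rdiag -rdiag_mxM.
by rewrite !mulmxA -[_ *m U *m _]mulmxA Uu mulmx1.
Qed.

Lemma mxtrace_conj_rdiag n (U : 'M[R[i]]_n) (d : 'rV[R]_n) : U \is unitarymx ->
  \tr (conj_rdiag U d) = (\sum_i d 0 i)%:C.
Proof.
move=> Uu; rewrite /conj_rdiag mxtrace_mulC mulmxA (unitarymxP Uu) mul1mx.
rewrite mxtrace_diag rmorph_sum /=.
by apply: eq_bigr => i _; rewrite mxE.
Qed.

Lemma det_conj_rdiag n (U : 'M[R[i]]_n) (d : 'rV[R]_n) : U \is unitarymx ->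
  \det (conj_rdiag U d) = (\prod_i d 0 i)%:C.
Proof.
move=> Uu; rewrite /conj_rdiag !det_mulmx mulrAC -det_mulmx.
rewrite trmxC_unitary_mul // det1 mul1r det_diag rmorph_prod /=.
by apply: eq_bigr => i _; rewrite mxE.
Qed.

Lemma char_poly_conj_rdiag n (U : 'M[R[i]]_n) (d : 'rV[R]_n) :
  U \is unitarymx ->
  char_poly (conj_rdiag U d) = \prod_(i < n) ('X - ((d 0 i)%:C)%:P).
Proof.
move=> Uu; rewrite /char_poly; set f := @polyC R[i].
have UU : map_mx f (U ^t*) *m map_mx f U = 1%:M.
  by rewrite -map_mxM trmxC_unitary_mul // map_mx1.
have -> : char_poly_mx (conj_rdiag U d)
        = map_mx f (U ^t*) *m char_poly_mx (rdiag_mx d) *m map_mx f U.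
  rewrite /char_poly_mx mulmxBr mulmxBl -!map_mxM; congr (_ - _).
  by rewrite scalar_mxC -mulmxA UU mulmx1.
rewrite !det_mulmx mulrAC -det_mulmx UU det1 mul1r.
rewrite -/(char_poly _) char_poly_trig ?diag_mx_is_trig //.
by apply: eq_bigr => i _; rewrite !mxE eqxx mulr1n.
Qed.

Lemma sort_ge_row n (d : 'rV[R]_n) :
  (forall i j : 'I_n, (i <= j)%N -> d 0 j <= d 0 i) ->
  sorted >=%R [seq d 0 j | j <- enum 'I_n].
Proof.
move=> dmon.
have ge_tr : transitive (>=%R : rel R).
  by move=> x y z yx xz; exact: le_trans yx.
rewrite sorted_map sorted_pairwise; last by move=> x y z; exact: ge_tr.
have : sorted ltn (map val (enum 'I_n)) by rewrite val_enum_ord iota_ltn_sorted.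
rewrite sorted_map sorted_pairwise; last by move=> x y z; exact: ltn_trans.
by apply: sub_pairwise => i j /= ij; apply: dmon; exact: ltnW.
Qed.

(** The characteristic polynomial determines the diagonal up to order, and a decreasing list is
    determined by its multiset. *)
Lemma eigvals_conj_rdiag n (U : 'M[R[i]]_n) (d : 'rV[R]_n) : U \is unitarymx ->
  (forall i j : 'I_n, (i <= j)%N -> d 0 j <= d 0 i) ->
  eigvals (conj_rdiag U d) = d.
Proof.
move=> Uu dmon; set H := conj_rdiag U d.
have HE := char_poly_eigvals (trmxC_conj_rdiag U d).
move: HE; rewrite char_poly_conj_rdiag //.
pose L (e : 'rV[R]_n) := [seq e 0 j | j <- enum 'I_n].
have toL (e : 'rV[R]_n) : \prod_(i < n) ('X - ((e 0 i)%:C)%:P)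
    = \prod_(x <- [seq z%:C | z <- L e]) ('X - x%:P).
  by rewrite 2!big_map big_enum.
rewrite !toL => /prod_XsubC_eq /(perm_map_inj (@complexI R)) pe.
have ge_tr : transitive (>=%R : rel R).
  by move=> x y z yx xz; exact: le_trans yx.
have ge_as : antisymmetric (>=%R : rel R).
  by move=> x y; rewrite andbC => /le_anti.
have LE := sorted_eq ge_tr ge_as (sort_ge_row dmon)
  (sort_ge_row (@eigvals_sorted _ _ _)) pe.
apply/rowP => i; have := congr1 (fun s => s`_i) LE.
rewrite (nth_map i) ?size_enum_ord //.
rewrite (nth_map i 0 (fun j => eigvals H 0 j)) ?size_enum_ord //.
by rewrite nth_ord_enum.
Qed.

(** Eigenvalues in the order of the rows of [spectralmx A], whereas [eigvals A] is sorted. *)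
Definition rspec n (A : 'M[R[i]]_n) : 'rV[R]_n :=
  map_mx (@complex.Re R) (spectral_diag A).

Lemma mxpowRE n (A : 'M[R[i]]_n) p :
  mxpowR A p = conj_rdiag (spectralmx A) (vpowR (rspec A) p).
Proof. by rewrite /conj_rdiag /rdiag_mx -!map_mx_comp. Qed.

Lemma hermitianE n (A : 'M[R[i]]_n) : A ^t* = A ->
  A = conj_rdiag (spectralmx A) (rspec A).
Proof.
move=> hA.
have hermA : A \is hermsymmx.
  by apply/is_hermitianmxP; rewrite expr0 scale1r hA.
have /mxOverP realD := hermitian_spectral_diag_real hermA.
have specE : map_mx (real_complex R) (rspec A) = spectral_diag A.
  by apply/rowP => i; rewrite !mxE RRe_real.
rewrite /conj_rdiag /rdiag_mx specE -(invmx_unitary (spectral_unitarymx A)).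
exact/orthomx_spectralP/hermitian_normalmx.
Qed.

Lemma psdmx_rspec_ge0 n (A : 'M[R[i]]_n) i : psdmx A -> 0 <= rspec A 0 i.
Proof.
(* The test vector is a unit eigenvector for [rspec A 0 i]. *)
move=> [hA posA]; have := posA ((spectralmx A) ^t* *m delta_mx i 0).
have /unitarymxP Uu := spectral_unitarymx A.
rewrite [X in _ *m X *m _]hermitianE // /conj_rdiag trmxC_mul trmxCK !mulmxA.
rewrite -2![_ *m spectralmx A *m _]mulmxA Uu !mulmx1.
rewrite -colE trmx_delta map_delta_mx -rowE.
by rewrite !mxE eqxx mulr1n ler0c.
Qed.

Lemma psdmx_gram m n (M : 'M[R[i]]_(m, n)) : psdmx (M ^t* *m M).
Proof.
split; first by rewrite trmxC_mul trmxCK.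
move=> x; have -> : x ^t* *m (M ^t* *m M) *m x = (M *m x) ^t* *m (M *m x).
  by rewrite trmxC_mul !mulmxA.
rewrite mxE; apply: sumr_ge0 => j _; rewrite !mxE mulrC; exact: mul_conjC_ge0.
Qed.

Lemma trmxC_mxpowR n (A : 'M[R[i]]_n) p : (mxpowR A p) ^t* = mxpowR A p.
Proof. by rewrite mxpowRE trmxC_conj_rdiag. Qed.

Lemma mxpowRD n (A : 'M[R[i]]_n) p q : 0 <= p -> 0 <= q ->
  mxpowR A p *m mxpowR A q = mxpowR A (p + q).
Proof.
move=> p0 q0; rewrite !mxpowRE (conj_rdiagM _ _ (spectral_unitarymx A)).
by congr conj_rdiag; apply/rowP => i; rewrite !mxE powRD_ge0.
Qed.

Lemma mxpowR1 n (A : 'M[R[i]]_n) : psdmx A -> mxpowR A 1 = A.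
Proof.
move=> psdA; rewrite mxpowRE [RHS]hermitianE; last by case: psdA.
congr conj_rdiag; apply/rowP => i; rewrite mxE powRr1 //.
exact: psdmx_rspec_ge0.
Qed.

Lemma mxpowR_half n (A : 'M[R[i]]_n) : psdmx A ->
  mxpowR A 2^-1 *m mxpowR A 2^-1 = A.
Proof.
have half_ge0 : 0 <= 2^-1 :> R by rewrite invr_ge0.
move=> psdA; rewrite (mxpowRD A half_ge0 half_ge0).
rewrite (_ : 2^-1 + 2^-1 = 1); last lra.
exact: mxpowR1.
Qed.

Lemma psdmx_mxpowR n (A : 'M[R[i]]_n) p : psdmx (mxpowR A p).
Proof.
have -> : mxpowR A p = (mxpowR A (p / 2)) ^t* *m mxpowR A (p / 2).
  rewrite trmxC_mxpowR !mxpowRE (conj_rdiagM _ _ (spectral_unitarymx A)).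
  congr conj_rdiag; apply/rowP => i; rewrite !mxE -expr2.
  by rewrite -powR_mulrn ?powR_ge0 // -powRrM divfK ?pnatr_eq0.
exact: psdmx_gram.
Qed.

Lemma eigvals_perm n (A : 'M[R[i]]_n) :
  exists s : 'S_n, forall i, eigvals A 0 i = rspec A 0 (s i).
Proof.
pose t := [tuple rspec A 0 j | j < n].
have tE : [seq complex.Re (spectral_diag A 0 j) | j <- enum 'I_n] = t.
  by rewrite /=; apply: eq_map => j; rewrite mxE.
have : perm_eq (sort >=%R t) t by rewrite perm_sort.
move=> /tuple_permP[s sE]; exists s => i; rewrite mxE tE sE.
rewrite (nth_map i) ?size_enum_ord // nth_ord_enum.
by rewrite tnth_mktuple.
Qed.

Lemma conj_rdiag_perm n (U : 'M[R[i]]_n) (d : 'rV[R]_n) (s : 'S_n) :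
  conj_rdiag (row_perm s U) (\row_j d 0 (s j)) = conj_rdiag U d.
Proof.
rewrite /conj_rdiag /rdiag_mx !mul_mx_diag; apply/matrixP => i j.
rewrite !mxE [RHS](reindex_perm s) /=.
by apply: eq_bigr => k _; rewrite !mxE.
Qed.

Lemma row_perm_unitary n (U : 'M[R[i]]_n) (s : 'S_n) :
  U \is unitarymx -> row_perm s U \is unitarymx.
Proof.
move=> /row_unitarymxP Uu; apply/row_unitarymxP => i j.
have rE k : row k (row_perm s U) = row (s k) U.
  by apply/rowP => x; rewrite !mxE.
by rewrite !rE Uu (inj_eq perm_inj).
Qed.

Lemma eigvals_ge0 n (A : 'M[R[i]]_n) i : psdmx A -> 0 <= eigvals A 0 i.
Proof.
by move=> psdA; have [s ->] := eigvals_perm A; exact: psdmx_rspec_ge0.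
Qed.

(** Permuting the rows of [spectralmx A] sorts the eigenvalues, and the same unitary serves all
    exponents. *)
Lemma eigvals_decomp n (A : 'M[R[i]]_n) : psdmx A ->
  exists2 U : 'M[R[i]]_n, U \is unitarymx & forall p,
    mxpowR A p = conj_rdiag U (vpowR (eigvals A) p).
Proof.
move=> psdA; have [s sE] := eigvals_perm A.
exists (row_perm s (spectralmx A)).
  exact/row_perm_unitary/spectral_unitarymx.
move=> p; rewrite mxpowRE -(conj_rdiag_perm _ _ s).
by congr conj_rdiag; apply/rowP => i; rewrite 2![LHS]mxE [RHS]mxE sE.
Qed.

Lemma vpowR1 n (d : 'rV[R]_n) : (forall i, 0 <= d 0 i) -> vpowR d 1 = d.
Proof. by move=> d0; apply/rowP => i; rewrite mxE powRr1. Qed.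

Lemma spectral_decomp n (A : 'M[R[i]]_n) : psdmx A ->
  exists2 U : 'M[R[i]]_n, U \is unitarymx & A = conj_rdiag U (eigvals A).
Proof.
move=> psdA; have [U Uu AE] := eigvals_decomp psdA; exists U => //.
rewrite -{1}(mxpowR1 psdA) AE vpowR1 // => i; exact: eigvals_ge0.
Qed.

Lemma eigvals_mxpowR n (A : 'M[R[i]]_n) p : psdmx A -> 0 <= p ->
  eigvals (mxpowR A p) = vpowR (eigvals A) p.
Proof.
move=> psdA p0; have [U Uu ->] := eigvals_decomp psdA.
apply: eigvals_conj_rdiag => // i j ij.
rewrite mxE [leRHS]mxE ge0_ler_powR ?nnegrE ?eigvals_ge0 //.
exact: eigvals_sorted.
Qed.

Definition topprod n (d : 'rV[R]_n) k : R := \prod_(i < n | (i < k)%N) d 0 i.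

Lemma topprod_eigvals_ge0 n (H : 'M[R[i]]_n) k : psdmx H ->
  0 <= topprod (eigvals H) k.
Proof. by move=> psdH; apply: prodr_ge0 => i _; exact: eigvals_ge0. Qed.

Lemma det_bound_eigvals n k (H : 'M[R[i]]_n) : psdmx H ->
  det_bound k H (topprod (eigvals H) k)%:C.
Proof.
move=> psdH V; have [U Uu HE] := spectral_decomp psdH.
have -> : V ^t* *m V = (U *m V) ^t* *m (U *m V).
  rewrite trmxC_mul mulmxA -[_ *m U]mulmxA trmxC_unitary_mul //.
  by rewrite mulmx1.
rewrite [X in _ *m X *m _]HE.
have -> : V ^t* *m conj_rdiag U (eigvals H) *m V
        = (U *m V) ^t* *m rdiag_mx (eigvals H) *m (U *m V).
  by rewrite trmxC_mul !mulmxA.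
apply: det_bound_diag => f finj.
rewrite (eq_bigr (fun i => (eigvals H 0 (f i))%:C)); last first.
  by move=> i _; rewrite mxE.
rewrite -rmorph_prod lecR; apply: prod_inj_le => // [i|].
  exact: eigvals_ge0.
exact: eigvals_sorted.
Qed.

(** The columns of [V] are orthonormal eigenvectors for the [k] largest eigenvalues, so the bound of
    [det_bound_eigvals] is attained on them. *)
Lemma topprod_eigvals_attained n k (H : 'M[R[i]]_n) : psdmx H -> (k <= n)%N ->
  exists (V : 'M[R[i]]_(n, k)) (D : 'M[R[i]]_k),
    [/\ V ^t* *m V = 1%:M, H *m V = V *m D
      & \det D = (topprod (eigvals H) k)%:C].
Proof.
move=> psdH le_kn; have [U Uu HE] := spectral_decomp psdH.
pose e := \row_(i < k) (eigvals H 0 (widen_ord le_kn i))%:C.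
exists (U ^t* *m pid_mx k), (diag_mx e); split.
- rewrite trmxC_mul trmxCK tr_pid_mx map_pid_mx mulmxA.
  rewrite -[_ *m U *m _]mulmxA (unitarymxP Uu) mulmx1 pid_mx_id //.
  by rewrite pid_mx_1.
- rewrite {1}HE /conj_rdiag !mulmxA -[_ *m U *m _]mulmxA (unitarymxP Uu) mulmx1.
  rewrite -!mulmxA; congr (_ *m _); rewrite mul_mx_diag mul_diag_mx.
  apply/matrixP => i j; rewrite !mxE.
  have [ij|ij] /= := eqVneq (i : nat) j; last by rewrite mulr0 mul0r.
  by rewrite mulrC ij.
- rewrite det_diag /topprod (big_ord_narrow le_kn) rmorph_prod.
  by apply: eq_bigr => i _; rewrite mxE.
Qed.

End Spectrum.

(** * The midpoint inequality *)

Section Midpoint.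
Local Open Scope complex_scope.
Local Open Scope sesquilinear_scope.
Variable R : realType.
Implicit Types (n l k : nat) (p q : R).

(** For positive semidefinite [X] and [Y], a positive semidefinite matrix with the eigenvalues of
    [X *m Y]. *)
Definition sandwich l (X Y : 'M[R[i]]_l) : 'M[R[i]]_l :=
  mxpowR X 2^-1 *m Y *m mxpowR X 2^-1.

Lemma gram_mul m n r (A : 'M[R[i]]_(m, n)) (B : 'M[R[i]]_(n, r)) :
  (A *m B) ^t* *m (A *m B) = B ^t* *m (A ^t* *m A) *m B.
Proof. by rewrite trmxC_mul !mulmxA. Qed.

Lemma sandwich_gram l (X Y : 'M[R[i]]_l) : psdmx Y ->
  sandwich X Y =
  (mxpowR Y 2^-1 *m mxpowR X 2^-1) ^t* *m (mxpowR Y 2^-1 *m mxpowR X 2^-1).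
Proof.
move=> psdY; rewrite gram_mul (trmxC_mxpowR X) (trmxC_mxpowR Y).
by rewrite (mxpowR_half psdY).
Qed.

Lemma psdmx_sandwich l (X Y : 'M[R[i]]_l) : psdmx Y -> psdmx (sandwich X Y).
Proof. by move=> psdY; rewrite (sandwich_gram X psdY); exact: psdmx_gram. Qed.

(** The Gram matrix is [F *m X *m F ^t*], that is [M ^t* *m M] with [M] the root of [X] times
    [F ^t*], while [M *m M ^t*] is the sandwich; [det_bound_swap] passes from one to the other. *)
Lemma det_bound_mul N N' l k (G : 'M[R[i]]_(N, l)) (F : 'M[R[i]]_(N', l))
    (X Y : 'M[R[i]]_l) : X = G ^t* *m G -> Y = F ^t* *m F ->
  det_bound k ((G *m F ^t*) ^t* *m (G *m F ^t*))
    (topprod (eigvals (sandwich X Y)) k)%:C.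
Proof.
move=> XE YE.
have psdX : psdmx X by rewrite XE; exact: psdmx_gram.
have psdY : psdmx Y by rewrite YE; exact: psdmx_gram.
pose M := mxpowR X 2^-1 *m F ^t*.
have -> : (G *m F ^t*) ^t* *m (G *m F ^t*) = M ^t* *m M.
  by rewrite /M 2!gram_mul (trmxC_mxpowR X) (mxpowR_half psdX) XE.
apply: det_bound_swap.
  by rewrite ler0c; exact/topprod_eigvals_ge0/psdmx_sandwich.
have -> : M *m M ^t* = sandwich X Y.
  by rewrite /sandwich YE /M trmxC_mul trmxCK trmxC_mxpowR !mulmxA.
exact/det_bound_eigvals/psdmx_sandwich.
Qed.

Lemma det_bound_mulC N N' l k (G : 'M[R[i]]_(N, l)) (F : 'M[R[i]]_(N', l))
    (X Y : 'M[R[i]]_l) : X = G ^t* *m G -> Y = F ^t* *m F ->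
  det_bound k ((F *m G ^t*) ^t* *m (F *m G ^t*))
    (topprod (eigvals (sandwich X Y)) k)%:C.
Proof.
move=> XE YE; apply: det_bound_swap.
  rewrite ler0c; apply/topprod_eigvals_ge0/psdmx_sandwich.
  by rewrite YE; exact: psdmx_gram.
have := det_bound_mul (k := k) XE YE.
have -> : (G *m F ^t*) ^t* *m (G *m F ^t*) = (F *m G ^t*) *m (F *m G ^t*) ^t*.
  by rewrite 2!trmxC_mul !trmxCK.
by [].
Qed.

(* Invariance of the columns of [V] under [Xh Y Xh] makes the columns of
   [F0 Xh V] invariant under [(F0 G0^* ) (G1 F1^* )], whose two factors are
   controlled separately. *)
Lemma invariant_det_le N N' l k (G0 G1 : 'M[R[i]]_(N, l))
    (F0 F1 : 'M[R[i]]_(N', l)) (X Y Xh : 'M[R[i]]_l) (V : 'M[R[i]]_(l, k)) D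
    (c c0 c1 : R) :
  X = G0 ^t* *m G1 -> Y = F1 ^t* *m F0 -> Xh *m Xh = X -> Xh ^t* = Xh ->
  V ^t* *m V = 1%:M -> Xh *m Y *m Xh *m V = V *m D -> \det D = c%:C ->
  0 <= c0 -> det_bound k ((F0 *m G0 ^t*) ^t* *m (F0 *m G0 ^t*)) c0%:C ->
  0 <= c1 -> det_bound k ((G1 *m F1 ^t*) ^t* *m (G1 *m F1 ^t*)) c1%:C ->
  c ^+ 2 <= c0 * c1.
Proof.
move=> XE YE XhXh Xh_herm VV HV detD c0_ge0 b0 c1_ge0 b1.
have [->|c_neq0] := eqVneq c 0; first by rewrite expr0n mulr_ge0.
pose W := F0 *m Xh *m V; pose W1 := F1 *m Xh *m V.
pose S0 := F0 *m G0 ^t*; pose S1 := G1 *m F1 ^t*.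
have SW : S0 *m (S1 *m W) = W *m D.
  rewrite /W -[RHS]mulmxA -HV /S0 /S1.
  rewrite !mulmxA -[_ *m Xh *m Xh]mulmxA XhXh XE YE.
  by rewrite !mulmxA.
have detWD : \det ((W *m D) ^t* *m (W *m D)) = c%:C ^+ 2 * \det (W ^t* *m W).
  rewrite trmxC_mul -mulmxA [_ *m (W *m D)]mulmxA 2!det_mulmx det_trmxC detD.
  rewrite [Num.conj _]conjc_real.
  by rewrite mulrCA mulrC expr2.
(* The bound [b0] is applied to [S1 *m W], then [b1] to [W]. *)
have le01 : c%:C ^+ 2 * \det (W ^t* *m W) <= (c0 * c1)%:C * \det (W ^t* *m W).
  rewrite -detWD -SW.
  rewrite gram_mul; apply: le_trans (b0 _) _.
  rewrite rmorphM -mulrA ler_wpM2l ?ler0c //.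
  by rewrite gram_mul; exact: b1.
(* The columns of [W] are independent: since [W1 ^t* *m W] equals [D], Cauchy-Schwarz would
   otherwise force [c] to vanish. *)
have W_gt0 : 0 < \det (W ^t* *m W).
  rewrite lt0r det_gram_ge0 andbT; apply: contra_neq c_neq0 => W0.
  have := det_gram_CauchySchwarz W1 W; rewrite [X in _ <= _ * X]W0 mulr0.
  have -> : W1 ^t* *m W = D.
    rewrite !trmxC_mul Xh_herm !mulmxA.
    transitivity (V ^t* *m (Xh *m Y *m Xh *m V)).
      by rewrite YE !mulmxA.
    by rewrite HV mulmxA VV mul1mx.
  rewrite detD => n0; apply/eqP; rewrite -(inj_eq (@complexI R)) -normr_eq0.
  by rewrite -sqrf_eq0 eq_le n0 exprn_ge0.
move: le01; rewrite ler_pM2r // -rmorphXn lecR //.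
Qed.

Lemma topprod_sandwich_le N N' l k (G0 G1 : 'M[R[i]]_(N, l))
    (F0 F1 : 'M[R[i]]_(N', l)) (X X0 X1 Y Y0 Y1 : 'M[R[i]]_l) : (k <= l)%N ->
  X = G0 ^t* *m G1 -> X0 = G0 ^t* *m G0 -> X1 = G1 ^t* *m G1 ->
  Y = F1 ^t* *m F0 -> Y0 = F0 ^t* *m F0 -> Y1 = F1 ^t* *m F1 ->
  psdmx X -> psdmx Y ->
  topprod (eigvals (sandwich X Y)) k ^+ 2 <=
  topprod (eigvals (sandwich X0 Y0)) k * topprod (eigvals (sandwich X1 Y1)) k.
Proof.
move=> le_kl XE X0E X1E YE Y0E Y1E psdX psdY.
have psdY0 : psdmx Y0 by rewrite Y0E; exact: psdmx_gram.
have psdY1 : psdmx Y1 by rewrite Y1E; exact: psdmx_gram.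
have [V [D [VV HV detD]]] :=
  topprod_eigvals_attained (psdmx_sandwich X psdY) le_kl.
apply: (invariant_det_le XE YE (mxpowR_half psdX) (trmxC_mxpowR _ _)
  VV HV detD).
- exact/topprod_eigvals_ge0/psdmx_sandwich.
- exact: det_bound_mulC.
- exact/topprod_eigvals_ge0/psdmx_sandwich.
- exact: det_bound_mul.
Qed.

End Midpoint.

(** * Gram factorizations and positive maps *)

Section PositiveMap.
Local Open Scope complex_scope.
Local Open Scope sesquilinear_scope.
Variable R : realType.
Implicit Types (n l k : nat) (p q r : R).

Definition spectral_proj n (A : 'M[R[i]]_n) (i : 'I_n) : 'M[R[i]]_n :=
  (row i (spectralmx A)) ^t* *m row i (spectralmx A).

Lemma mxpowR_sum n (A : 'M[R[i]]_n) p :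
  mxpowR A p = \sum_i (rspec A 0 i `^ p)%:C *: spectral_proj A i.
Proof.
rewrite mxpowRE /conj_rdiag /rdiag_mx mul_mx_diag.
apply/matrixP => i j; rewrite mxE summxE; apply: eq_bigr => k _.
by rewrite !mxE big_ord1 !mxE mulrCA mulrA.
Qed.

Lemma trmxC_scale m n (a : R[i]) (M : 'M[R[i]]_(m, n)) :
  (a *: M) ^t* = Num.conj a *: M ^t*.
Proof. by apply/matrixP => i j; rewrite !mxE rmorphM. Qed.

(** All powers of [A] combine the same projections, with weights that split as a factor in [q] times
    a factor in [r]. Hence one family [G] serves every pair of exponents, and plain positivity of
    [Phi] suffices to take the roots [S i]. *)
Lemma positive_map_gram n l (Phi : {linear 'M[R[i]]_n -> 'M[R[i]]_l})
    (A : 'M[R[i]]_n) : positive_map Phi ->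
  exists N (G : R -> 'M[R[i]]_(N, l)), forall q r, 0 <= q -> 0 <= r ->
    Phi (mxpowR A ((q + r) / 2)) = (G q) ^t* *m G r.
Proof.
move=> posPhi; pose S i := mxpowR (Phi (spectral_proj A i)) 2^-1.
pose w q i := (rspec A 0 i `^ (q / 2))%:C.
exists (\sum_(i < n) l)%N, (fun q => \mxcol_i (w q i *: S i)) => q r q0 r0.
have -> : (\mxcol_i (w q i *: S i)) ^t* = \mxrow_i ((w q i *: S i) ^t*).
  by rewrite tr_mxcol; apply/matrixP => i j; rewrite !mxE.
rewrite mul_mxrow_mxcol mxpowR_sum raddf_sum /=; apply: eq_bigr => i _.
have psdPi : psdmx (Phi (spectral_proj A i)) by exact/posPhi/psdmx_gram.
rewrite linearZ /= -[Phi _](mxpowR_half psdPi).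
rewrite trmxC_scale (trmxC_mxpowR (Phi (spectral_proj A i))).
rewrite -scalemxAl -scalemxAr scalerA; congr (_ *: _).
rewrite [Num.conj _]conjc_real -rmorphM /= -powRD_ge0 ?divr_ge0 //.
by congr (_ `^ _)%:C; lra.
Qed.

(** The base [1 + x] is at least one, so its powers increase with the exponent; this makes the next
    bound uniform in [p]. *)
Lemma powR_le_powR1D (x p q : R) : 0 <= x -> 0 <= p <= q ->
  x `^ p <= (1 + x) `^ q.
Proof.
move=> x0 /andP[p0 pq]; apply: (@le_trans _ _ ((1 + x) `^ p)).
  by rewrite ge0_ler_powR ?nnegrE //; lra.
by rewrite ler_powR //; lra.
Qed.

Lemma positive_map_entry_bounded n l (Phi : {linear 'M[R[i]]_n -> 'M[R[i]]_l})
    (A : 'M[R[i]]_n) q : psdmx A ->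
  exists2 c : R[i], 0 <= c & forall p, 0 <= p <= q ->
    forall i j, `|Phi (mxpowR A p) i j| <= c.
Proof.
move=> psdA.
pose b i j :=
  \sum_s ((1 + rspec A 0 s) `^ q)%:C * `|Phi (spectral_proj A s) i j|.
have w_ge0 s : 0 <= ((1 + rspec A 0 s) `^ q)%:C by rewrite ler0c powR_ge0.
have b_ge0 i j : 0 <= b i j by apply: sumr_ge0 => s _; rewrite mulr_ge0.
exists (\sum_i \sum_j b i j) => [|p pq i j].
  by apply: sumr_ge0 => i _; apply: sumr_ge0.
apply: (@le_trans _ _ (b i j)); last first.
  rewrite (bigD1 i) //= (bigD1 j) //= -addrA lerDl addr_ge0 //.
    exact: sumr_ge0.
  by apply: sumr_ge0 => i' _; apply: sumr_ge0.
rewrite mxpowR_sum raddf_sum /= summxE; apply: le_trans (ler_norm_sum _ _ _) _.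
apply: ler_sum => s _; rewrite linearZ mxE normrM ler_wpM2r //.
rewrite ger0_norm ?ler0c ?powR_ge0 // lecR powR_le_powR1D //.
exact: psdmx_rspec_ge0.
Qed.

(** Each eigenvalue is at most the trace of the sandwich, which is the trace of [X *m Y] and is
    controlled by the entries. Boundedness is the right regularity here: for singular [A] the power
    of [A] jumps at exponent zero. *)
Lemma topprod_sandwich_bounded n m l k
    (Phi : {linear 'M[R[i]]_n -> 'M[R[i]]_l})
    (Psi : {linear 'M[R[i]]_m -> 'M[R[i]]_l}) (A : 'M[R[i]]_n) (B : 'M[R[i]]_m)
    q :
  positive_map Phi -> positive_map Psi -> psdmx A -> psdmx B ->
  exists c : R, forall p, 0 <= p <= q ->
    topprod (eigvals (sandwich (Phi (mxpowR A p)) (Psi (mxpowR B p)))) k <= c.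
Proof.
move=> posPhi posPsi psdA psdB.
have [a a0 Ha] := positive_map_entry_bounded Phi q psdA.
have [b b0 Hb] := positive_map_entry_bounded Psi q psdB.
pose t := complex.Re (\sum_(i < l) \sum_(j < l) a * b).
exists (\prod_(i < l | (i < k)%N) t) => p pq.
move: (Phi _) (Psi _) (Ha p pq) (Hb p pq) (posPhi _ (psdmx_mxpowR A p))
  (posPsi _ (psdmx_mxpowR B p)) => X Y {Ha Hb} Ha Hb psdX psdY.
have psdH := psdmx_sandwich X psdY.
have trH : (\sum_i eigvals (sandwich X Y) 0 i)%:C = \tr (X *m Y).
  have [U Uu HE] := spectral_decomp psdH.
  rewrite -(mxtrace_conj_rdiag _ Uu) -HE /sandwich mxtrace_mulC mulmxA.
  by rewrite mxpowR_half.
apply: ler_prod => i _; rewrite eigvals_ge0 //=.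
apply: (@le_trans _ _ (\sum_i eigvals (sandwich X Y) 0 i)).
  rewrite (bigD1 i) //= lerDl; apply: sumr_ge0 => j _; exact: eigvals_ge0.
rewrite -lecR trH.
have ab0 : 0 <= \sum_(i < l) \sum_(j < l) a * b.
  by apply: sumr_ge0 => ? _; apply: sumr_ge0 => ? _; rewrite mulr_ge0.
rewrite RRe_real ?ger0_real //.
have tr0 : 0 <= \tr (X *m Y).
  by rewrite -trH ler0c; apply: sumr_ge0 => j _; exact: eigvals_ge0.
rewrite -(ger0_norm tr0); apply: le_trans (ler_norm_sum _ _ _) _.
apply: ler_sum => j _; rewrite mxE; apply: le_trans (ler_norm_sum _ _ _) _.
by apply: ler_sum => s _; rewrite normrM ler_pM.
Qed.

End PositiveMap.

(** * Bounded midpoint log-convex functions *)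

Section LogConvex.
Variable R : realType.
Implicit Types (f : R -> R) (s t x c : R).

(** For [x] above one, the Bernoulli inequality [bern] makes the powers unbounded. *)
Lemma expn_bounded_le1 x c : (forall N, x ^+ (2 ^ N) <= c) -> x <= 1.
Proof.
move=> xc; rewrite leNgt; apply/negP => x1.
have bern N : 1 + (x - 1) *+ N <= x ^+ N.
  elim: N => [|N IH]; first by rewrite mulr0n addr0 expr0.
  have x0 : 0 <= x by lra.
  rewrite exprS; apply: le_trans (ler_wpM2l x0 IH).
  have : 0 <= (x - 1) * ((x - 1) *+ N) by rewrite mulr_ge0 ?mulrn_wge0; lra.
  by rewrite mulrSr; move: (_ *+ N) => y; lra.
have x10 : 0 < x - 1 by lra.
have c0 : 0 <= `|c| / (x - 1) by rewrite divr_ge0 // ltW.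
have := archi_boundP c0; set N := Num.bound _; rewrite ltr_pdivrMr // => cN.
have := xc N; apply/negP; rewrite -ltNge.
apply: (le_lt_trans (ler_norm c)); apply: lt_le_trans cN _.
rewrite mulr_natl; apply: le_trans (_ : (x - 1) *+ (2 ^ N) <= _).
  by rewrite ler_wpMn2l ?(ltW x10) // (ltnW (ltn_expl _ _)).
by apply: le_trans (bern _); rewrite lerDr.
Qed.

Definition midpoint_log_convex f : Prop :=
  forall s t, 0 <= s <= 1 -> 0 <= t <= 1 -> f ((s + t) / 2) ^+ 2 <= f s * f t.

(** The point [t] is the midpoint of [0] and [2 * t], or of [2 * t - 1] and [1]. The first case
    gives zero at once; the second doubles the distance to [1], so the first case or the point [0]
    is reached after finitely many steps, counted by [N]. *)
Lemma midpoint_log_convex_eq0 f t : (forall x, 0 <= f x) ->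
  midpoint_log_convex f -> f 0 = 0 -> 0 <= t < 1 -> f t = 0.
Proof.
move=> f0 fmid f00 /andP[t0 t1].
suff H N : forall t, 0 <= t -> 1 <= (1 - t) * (2 ^ N)%:R -> f t = 0.
  have t10 : 0 < 1 - t by lra.
  have it0 : 0 <= (1 - t)^-1 by rewrite invr_ge0 ltW.
  have := archi_boundP it0; set N := Num.bound _ => HN; apply: (H N) => //.
  rewrite -ler_pdivrMl ?mulr1 //.
  by rewrite (le_trans (ltW HN)) // ler_nat (ltnW (ltn_expl _ _)).
have sq0 x y : f x ^+ 2 <= y -> y = 0 -> f x = 0.
  move=> xy y0; apply/eqP; rewrite -sqrf_eq0 eq_le exprn_ge0 // andbT.
  by rewrite -y0.
elim: N => [|N IH] {t0 t1}t t0.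
  by rewrite expn0 mulr1 => t1; have -> : t = 0 by lra.
rewrite expnS natrM => Ht.
have le_tt : 1 <= (1 - (2 * t - 1)) * (2 ^ N)%:R by move: Ht; lra.
have tlt1 : t <= 1.
  rewrite leNgt; apply/negP => t1; have : (1 - t) * (2%:R * (2 ^ N)%:R) <= 0.
    by rewrite mulr_le0_ge0 ?mulr_ge0 //; lra.
  lra.
have [t2|t2] := leP (2 * t - 1) 0.
  have := fmid 0 (2 * t) (ltac:(lra)) (ltac:(lra)).
  have -> : (0 + 2 * t) / 2 = t by lra.
  by move=> /sq0 -> //; rewrite f00 mul0r.
have := fmid (2 * t - 1) 1 (ltac:(lra)) (ltac:(lra)).
have -> : (2 * t - 1 + 1) / 2 = t by lra.
by move=> /sq0 -> //; rewrite (IH (2 * t - 1)) ?mul0r //; lra.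
Qed.

Lemma midpoint_log_convex_rev f :
  midpoint_log_convex f -> midpoint_log_convex (fun t => f (1 - t)).
Proof.
move=> fmid s t s01 t01.
have -> : 1 - (s + t) / 2 = ((1 - s) + (1 - t)) / 2 by lra.
by apply: fmid; lra.
Qed.

(* Boundedness replaces continuity: reflecting [t] in the nearer endpoint
   bounds [h t ^+ 2] by another value of [h], where [h] is [f] divided by the
   log-affine interpolation of its end values; iterating, all the
   [h t ^+ (2 ^ N)] are bounded by one constant. *)
Lemma midpoint_log_convex_le f c t : (forall x, 0 <= f x) ->
  midpoint_log_convex f -> (forall x, 0 <= x <= 1 -> f x <= c) ->
  0 <= t <= 1 -> f t <= f 0 `^ (1 - t) * f 1 `^ t.
Proof.
move=> f0 fmid fc t01.
have [->|t_neq0] := eqVneq t 0; first by rewrite subr0 powRr1 // powRr0 mulr1.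
have [->|t_neq1] := eqVneq t 1; first by rewrite subrr powRr1 // powRr0 mul1r.
have t01' : 0 < t < 1.
  by rewrite !lt_neqAle eq_sym t_neq0 t_neq1.
have rhs_ge0 : 0 <= f 0 `^ (1 - t) * f 1 `^ t by rewrite mulr_ge0 ?powR_ge0.
(* A vanishing end value is set apart, since the interpolation [g] will be a divisor. *)
have [f00|f00] := eqVneq (f 0) 0.
  by rewrite (midpoint_log_convex_eq0 f0 fmid f00) //; lra.
have [f10|f10] := eqVneq (f 1) 0.
  have f10' : f (1 - 0) = 0 by rewrite subr0.
  have /= := midpoint_log_convex_eq0 (fun x => f0 (1 - x))
    (midpoint_log_convex_rev fmid) f10' (t := 1 - t).
  have -> : 1 - (1 - t) = t by lra.
  by move=> -> //; lra.
have f0_gt0 : 0 < f 0 by rewrite lt0r f00 f0.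
have f1_gt0 : 0 < f 1 by rewrite lt0r f10 f0.
pose g x := f 0 `^ (1 - x) * f 1 `^ x.
have g_gt0 x : 0 < g x by rewrite mulr_gt0 // powR_gt0.
have powD a x y : 0 < a -> a `^ (x + y) = a `^ x * a `^ y.
  by move=> a0; rewrite powRD // (gt_eqF a0) implybT.
have gmid x y : g ((x + y) / 2) ^+ 2 = g x * g y.
  rewrite expr2 /g mulrACA -!powD // [RHS]mulrACA -!powD //.
  by congr (_ `^ _ * _ `^ _); lra.
pose h x := f x / g x.
have h_ge0 x : 0 <= h x by rewrite divr_ge0 // ltW.
have hmid x y : 0 <= x <= 1 -> 0 <= y <= 1 -> h ((x + y) / 2) ^+ 2 <= h x * h y.
  move=> x01 y01; rewrite /h expr_div_n gmid [leRHS]mulrACA -invfM.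
  rewrite ler_wpM2r ?fmid //.
  by rewrite invr_ge0 mulr_ge0 // ltW.
have h0 : h 0 = 1 by rewrite /h /g subr0 powRr1 // powRr0 mulr1 divff.
have h1 : h 1 = 1 by rewrite /h /g subrr powRr1 // powRr0 mul1r divff.
(* A lower bound for [g] on the unit interval, so that [c / m] bounds [h] there. *)
pose m := Num.min 1 (f 0) * Num.min 1 (f 1).
have min_powR y x : 0 < y -> 0 <= x <= 1 -> Num.min 1 y <= y `^ x.
  move=> y0 x01; have [y1|y1] := leP 1 y.
    by rewrite -[leLHS](powRr0 y); apply: ler_powR => //; lra.
  by apply: ger1_powR; lra.
have m_gt0 : 0 < m by rewrite mulr_gt0 // lt_min ltr01.
have mg x : 0 <= x <= 1 -> m <= g x.
  move=> x01; apply: ler_pM; rewrite ?min_powR ?le_min ?ler01 ?f0 //.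
  by lra.
have c_ge0 : 0 <= c by apply: le_trans (f0 0) (fc 0 _); lra.
have hc N : forall x, 0 <= x <= 1 -> h x ^+ (2 ^ N) <= c / m.
  elim: N => [|N IH] x x01.
    rewrite expn0 expr1; apply: ler_pM;
      rewrite ?fc ?invr_ge0 ?(ltW (g_gt0 x)) //.
    by rewrite lef_pV2 ?posrE ?mg.
  rewrite expnS exprM.
  have [x2|x2] := leP x (1 - x).
    have x2' : 0 <= 2 * x <= 1 by lra.
    apply: le_trans (IH (2 * x) x2').
    apply: lerXn2r; rewrite ?nnegrE ?exprn_ge0 //.
    have := hmid 0 (2 * x) (ltac:(lra)) x2'.
    by rewrite h0 mul1r (_ : (0 + 2 * x) / 2 = x) //; lra.
  have x2' : 0 <= 2 * x - 1 <= 1 by lra.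
  apply: le_trans (IH (2 * x - 1) x2').
  apply: lerXn2r; rewrite ?nnegrE ?exprn_ge0 //.
  have := hmid (2 * x - 1) 1 x2' (ltac:(lra)).
  by rewrite h1 mulr1 (_ : (2 * x - 1 + 1) / 2 = x) //; lra.
have : h t <= 1 by apply: (@expn_bounded_le1 _ (c / m)) => N; exact: hc.
by rewrite ler_pdivrMr // mul1r.
Qed.

End LogConvex.

(** * Log-majorization *)

Section Majorization.
Local Open Scope complex_scope.
Local Open Scope sesquilinear_scope.
Variable R : realType.
Implicit Types (n l k : nat) (p q r s t alpha : R).

(** The swapped determinant bound is evaluated on the top eigenvectors of [M ^t* *m M]. *)
Lemma topprod_eigvals_le_mulC m n k (M : 'M[R[i]]_(m, n)) : (k <= n)%N ->
  topprod (eigvals (M ^t* *m M)) k <= topprod (eigvals (M *m M ^t*)) k.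
Proof.
move=> le_kn; have psd1 := psdmx_gram M.
have psd2 : psdmx (M *m M ^t*) by rewrite -{1}(trmxCK M); exact: psdmx_gram.
have [V [D [VV HV detD]]] := topprod_eigvals_attained psd1 le_kn.
have b : det_bound k (M ^t* *m M) (topprod (eigvals (M *m M ^t*)) k)%:C.
  apply: det_bound_swap; last exact: det_bound_eigvals.
  by rewrite ler0c; exact: topprod_eigvals_ge0.
have := b V; rewrite -mulmxA HV mulmxA VV mul1mx det1 mulr1 detD.
by rewrite lecR.
Qed.

Lemma topprod_eigvals_mulC n k (M : 'M[R[i]]_n) : (k <= n)%N ->
  topprod (eigvals (M ^t* *m M)) k = topprod (eigvals (M *m M ^t*)) k.
Proof.
move=> le_kn; apply/le_anti; rewrite topprod_eigvals_le_mulC //=.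
have := topprod_eigvals_le_mulC (M ^t*) le_kn.
by rewrite (trmxCK M).
Qed.

Lemma topprod_vpowR n k (d : 'rV[R]_n) p : (forall i, 0 <= d 0 i) ->
  topprod (vpowR d p) k = topprod d k `^ p.
Proof.
by move=> d0; rewrite /topprod powR_prod //; apply: eq_bigr => i _; rewrite mxE.
Qed.

Lemma topprod_vmul n k (d e : 'rV[R]_n) :
  topprod (vmul d e) k = topprod d k * topprod e k.
Proof. by rewrite /topprod -big_split; apply: eq_bigr => i _; rewrite mxE. Qed.

Lemma singvalsE n (S : 'M[R[i]]_n) :
  singvals S = vpowR (eigvals (S ^t* *m S)) 2^-1.
Proof.
by rewrite /singvals eigvals_mxpowR ?invr_ge0 //; exact: psdmx_gram.
Qed.

Lemma singvals_ge0 n (S : 'M[R[i]]_n) i : 0 <= singvals S 0 i.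
Proof. by rewrite singvalsE mxE powR_ge0. Qed.

Lemma topprod_singvals n k (S : 'M[R[i]]_n) :
  topprod (singvals S) k = topprod (eigvals (S ^t* *m S)) k `^ 2^-1.
Proof.
by rewrite singvalsE topprod_vpowR // => i; apply/eigvals_ge0/psdmx_gram.
Qed.

(** The two matrices are the two Gram products of [Q *m P]. *)
Lemma topprod_eigvals_swap n k (P Q X Y : 'M[R[i]]_n) : (k <= n)%N ->
  P ^t* = P -> Q ^t* = Q -> P *m P = X -> Q *m Q = Y ->
  topprod (eigvals (P *m Y *m P)) k = topprod (eigvals (Q *m X *m Q)) k.
Proof.
move=> le_kn hP hQ PP QQ.
have -> : P *m Y *m P = (Q *m P) ^t* *m (Q *m P) by rewrite gram_mul hP hQ QQ.
rewrite (topprod_eigvals_mulC _ le_kn) trmxC_mul hP hQ -PP.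
by rewrite !mulmxA.
Qed.

Lemma topprod_singvals_mul n k (P Q Y : 'M[R[i]]_n) : (k <= n)%N ->
  P ^t* = P -> Q ^t* = Q -> Q *m Q = Y ->
  topprod (singvals (P *m Q)) k = topprod (eigvals (P *m Y *m P)) k `^ 2^-1.
Proof.
move=> le_kn hP hQ QQ; rewrite topprod_singvals gram_mul hP hQ.
by rewrite -(topprod_eigvals_swap le_kn hP hQ erefl QQ).
Qed.

Lemma topprod_singvals_half l k (X Y : 'M[R[i]]_l) : (k <= l)%N -> psdmx Y ->
  topprod (singvals (mxpowR X 2^-1 *m mxpowR Y 2^-1)) k =
  topprod (eigvals (sandwich X Y)) k `^ 2^-1.
Proof.
move=> le_kl psdY.
exact: topprod_singvals_mul le_kl (trmxC_mxpowR _ _) (trmxC_mxpowR _ _)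
  (mxpowR_half psdY).
Qed.

(** Squaring singular values doubles the exponent. This brings the products of powers under the
    result for maps, with identity maps and the roles of [A] and [B] exchanged. *)
Lemma topprod_singvals_mxpowR n k (A B : 'M[R[i]]_n) q : (k <= n)%N ->
  0 <= q ->
  topprod (singvals (mxpowR A q *m mxpowR B q)) k =
  topprod (eigvals (sandwich (mxpowR B (2 * q)) (mxpowR A (2 * q)))) k `^ 2^-1.
Proof.
move=> le_kn q0.
have sq (C : 'M[R[i]]_n) : mxpowR C q *m mxpowR C q = mxpowR C (2 * q).
  by rewrite (mxpowRD C q0 q0) (_ : q + q = 2 * q); [|lra].
rewrite (topprod_singvals_mul le_kn (trmxC_mxpowR A q) (trmxC_mxpowR B q)
  (sq B)).
have halfB := mxpowR_half (psdmx_mxpowR B (2 * q)).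
have E := topprod_eigvals_swap le_kn (trmxC_mxpowR A q)
  (trmxC_mxpowR (mxpowR B (2 * q)) 2^-1) (sq A) halfB.
exact: (congr1 (fun x => x `^ 2^-1) E).
Qed.

Definition topprod_maps n m l k (Phi : 'M[R[i]]_n -> 'M[R[i]]_l)
    (Psi : 'M[R[i]]_m -> 'M[R[i]]_l) A B q : R :=
  topprod (eigvals (sandwich (Phi (mxpowR A q)) (Psi (mxpowR B q)))) k.

Lemma topprod_maps_log_convex n m l k
    (Phi : {linear 'M[R[i]]_n -> 'M[R[i]]_l})
    (Psi : {linear 'M[R[i]]_m -> 'M[R[i]]_l}) (A : 'M[R[i]]_n) (B : 'M[R[i]]_m)
    p0 p1 alpha :
  positive_map Phi -> positive_map Psi -> psdmx A -> psdmx B ->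
  0 <= p0 -> 0 <= p1 -> 0 <= alpha <= 1 -> (k <= l)%N ->
  topprod_maps k Phi Psi A B ((1 - alpha) * p0 + alpha * p1) <=
  topprod_maps k Phi Psi A B p0 `^ (1 - alpha) *
  topprod_maps k Phi Psi A B p1 `^ alpha.
Proof.
move=> posPhi posPsi psdA psdB p0_ge0 p1_ge0 alpha01 le_kl.
pose g := topprod_maps k Phi Psi A B.
pose a t : R := (1 - t) * p0 + t * p1.
have a_ge0 t : 0 <= t <= 1 -> 0 <= a t.
  by move=> t01; rewrite /a addr_ge0 // mulr_ge0 //; lra.
have psdPhi q : psdmx (Phi (mxpowR A q)) by exact/posPhi/psdmx_mxpowR.
have psdPsi q : psdmx (Psi (mxpowR B q)) by exact/posPsi/psdmx_mxpowR.
have g_ge0 q : 0 <= g q by exact/topprod_eigvals_ge0/psdmx_sandwich.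
have [N [G GE]] := positive_map_gram A posPhi.
have [N' [F FE]] := positive_map_gram B posPsi.
have gmid q r : 0 <= q -> 0 <= r -> g ((q + r) / 2) ^+ 2 <= g q * g r.
  move=> q0 r0; have half (s : R) : s = (s + s) / 2 by lra.
  apply: (@topprod_sandwich_le _ _ _ _ _ (G q) (G r) (F q) (F r)) => //.
  - exact: GE.
  - by rewrite {1}[q]half; exact: GE.
  - by rewrite {1}[r]half; exact: GE.
  (* [Psi] is factored in the opposite order, with [F r] on the left, as the invariance argument
     requires. *)
  - by rewrite addrC; exact: FE.
  - by rewrite {1}[q]half; exact: FE.
  - by rewrite {1}[r]half; exact: FE.
have fmid : midpoint_log_convex (g \o a).
  move=> s t s01 t01 /=; have -> : a ((s + t) / 2) = (a s + a t) / 2.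
    by rewrite /a; lra.
  by apply: gmid; exact: a_ge0.
(* The exponent [p0 + p1] dominates every [a t] on the segment. *)
have [c gc] := topprod_sandwich_bounded k (p0 + p1) posPhi posPsi psdA psdB.
have fc t : 0 <= t <= 1 -> (g \o a) t <= c.
  move=> t01; apply: gc; rewrite a_ge0 //= /a lerD // ler_piMl //; lra.
rewrite -/(g _) -/(g p0) -/(g p1).
have := midpoint_log_convex_le (fun t => g_ge0 (a t)) fmid fc alpha01.
rewrite /= /a.
have -> : (1 - 0) * p0 + 0 * p1 = p0 by lra.
by have -> : (1 - 1) * p0 + 1 * p1 = p1 by lra.
Qed.

(** With [r] one half, this carries the inequality from eigenvalues to singular values. *)
Lemma powR_interp (x y z x' y' z' p q r : R) :
  x' = x `^ r -> y' = y `^ r -> z' = z `^ r ->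
  0 <= x -> 0 <= y -> 0 <= z -> 0 <= r ->
  x <= y `^ p * z `^ q -> x' <= y' `^ p * z' `^ q.
Proof.
move=> -> -> -> x0 y0 z0 r0 xyz.
rewrite powRAC [(z `^ r) `^ q]powRAC -powRM ?powR_ge0 //.
by rewrite ge0_ler_powR ?nnegrE // mulr_ge0 ?powR_ge0.
Qed.

Lemma wlog_major_interp n (a d e : 'rV[R]_n) p q :
  (forall i, 0 <= d 0 i) -> (forall i, 0 <= e 0 i) ->
  (forall k, (k <= n)%N ->
    topprod a k <= topprod d k `^ p * topprod e k `^ q) ->
  wlog_major a (vmul (vpowR d p) (vpowR e q)).
Proof.
move=> d0 e0 ade k /andP[_ le_kn].
rewrite -[leLHS]/(topprod a k) -[leRHS]/(topprod _ k).
by rewrite topprod_vmul !topprod_vpowR //; exact: ade.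
Qed.

Lemma prod_eigvals n (H : 'M[R[i]]_n) : psdmx H ->
  (\prod_i eigvals H 0 i)%:C = \det H.
Proof.
move=> psdH; have [U Uu HE] := spectral_decomp psdH.
by rewrite [in RHS]HE (det_conj_rdiag _ Uu).
Qed.

Lemma det_mxpowR n (A : 'M[R[i]]_n) q : psdmx A ->
  \det (mxpowR A q) = ((\prod_i rspec A 0 i) `^ q)%:C.
Proof.
move=> psdA; rewrite mxpowRE det_conj_rdiag ?spectral_unitarymx //.
rewrite powR_prod => [|i]; last exact: psdmx_rspec_ge0.
by congr _%:C; apply: eq_bigr => i _; rewrite mxE.
Qed.

(** The product of all singular values is the modulus of the determinant, which is
    multiplicative. *)
Lemma prod_singvals_mxpowR n (A B : 'M[R[i]]_n) q : psdmx A -> psdmx B ->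
  \prod_i singvals (mxpowR A q *m mxpowR B q) 0 i =
  (\prod_i rspec A 0 i) `^ q * (\prod_i rspec B 0 i) `^ q.
Proof.
move=> psdA psdB; set a := (\prod_i rspec A 0 i) `^ q.
set b := (\prod_i rspec B 0 i) `^ q.
have ab0 : 0 <= a * b by rewrite mulr_ge0 ?powR_ge0.
have -> : \prod_i singvals (mxpowR A q *m mxpowR B q) 0 i =
    topprod (singvals (mxpowR A q *m mxpowR B q)) n.
  by apply: eq_bigl => i; rewrite ltn_ord.
rewrite topprod_singvals; set H := _ *m _.
have -> : topprod (eigvals H) n = (a * b) ^+ 2.
  apply: (@complexI R); rewrite [LHS](_ : _ = \det H); last first.
    rewrite -prod_eigvals; last exact: psdmx_gram.
    by congr _%:C; apply: eq_bigl => i; rewrite ltn_ord.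
  rewrite /H det_mulmx det_trmxC det_mulmx !det_mxpowR // -/a -/b -rmorphM.
  by rewrite [Num.conj _]conjc_real -rmorphM expr2.
by rewrite powR12_sqrt ?exprn_ge0 // sqrtr_sqr ger0_norm.
Qed.

End Majorization.

Unset Implicit Arguments.
Set Strict Implicit.

Theorem theorem3p1 (R : realType) (n m l : nat)
    (Phi : {linear 'M[R[i]]_n -> 'M[R[i]]_l})
    (Psi : {linear 'M[R[i]]_m -> 'M[R[i]]_l})
    (p0 p1 alpha : R) :
  positive_map Phi -> positive_map Psi ->
  0 <= p0 -> 0 <= p1 -> 0 <= alpha <= 1 ->
  let p := (1 - alpha) * p0 + alpha * p1 in
  (forall (A : 'M[R[i]]_n) (B : 'M[R[i]]_m), psdmx A -> psdmx B ->
    let Lam (q : R) :=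
      eigvals (Phi (A ^^ q) ^^ 2^-1 *m Psi (B ^^ q) *m Phi (A ^^ q) ^^ 2^-1) in
    let Sig (q : R) :=
      singvals (Phi (A ^^ q) ^^ 2^-1 *m Psi (B ^^ q) ^^ 2^-1) in
    wlog_major (Lam p)
      (vmul (vpowR (Lam p0) (1 - alpha)) (vpowR (Lam p1) alpha)) /\
    wlog_major (Sig p)
      (vmul (vpowR (Sig p0) (1 - alpha)) (vpowR (Sig p1) alpha))) /\
  (forall A B : 'M[R[i]]_n, psdmx A -> psdmx B ->
    let sig (q : R) := singvals (A ^^ q *m B ^^ q) in
    log_major (sig p)
      (vmul (vpowR (sig p0) (1 - alpha)) (vpowR (sig p1) alpha))).
Proof.
move=> posPhi posPsi p0_ge0 p1_ge0 alpha01 p.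
have p_ge0 : 0 <= p by rewrite /p addr_ge0 // mulr_ge0 //; lra.
split=> [A B psdA psdB Lam Sig | A B psdA psdB sig].
  have psdPsi q : psdmx (Psi (B ^^ q)) by exact/posPsi/psdmx_mxpowR.
  have Lam_ge0 q i : 0 <= Lam q 0 i by exact/eigvals_ge0/psdmx_sandwich.
  have convex k : (k <= l)%N -> topprod (Lam p) k <=
      topprod (Lam p0) k `^ (1 - alpha) * topprod (Lam p1) k `^ alpha.
    exact: topprod_maps_log_convex.
  have Lam_top q k : 0 <= topprod (Lam q) k by apply: prodr_ge0.
  split; apply: wlog_major_interp; first exact: Lam_ge0.
  - exact: Lam_ge0.
  - exact: convex.
  - by move=> i; exact: singvals_ge0.
  - by move=> i; exact: singvals_ge0.
  have SigE q k : (k <= l)%N -> topprod (Sig q) k = topprod (Lam q) k `^ 2^-1.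
    by move=> le_kl; exact: topprod_singvals_half.
  move=> k le_kl.
  apply: (powR_interp (SigE p k le_kl) (SigE p0 k le_kl) (SigE p1 k le_kl)).
  - exact: Lam_top.
  - exact: Lam_top.
  - exact: Lam_top.
  - by rewrite invr_ge0.
  - exact: convex.
split.
  apply: wlog_major_interp; try by move=> i; exact: singvals_ge0.
  move=> k le_kn.
  have sigE q (q0 : 0 <= q) := topprod_singvals_mxpowR A B le_kn q0.
  have psd_ge0 (X : 'M[R[i]]_n) q :
      0 <= topprod (eigvals (sandwich X (A ^^ q))) k.
    exact/topprod_eigvals_ge0/psdmx_sandwich/psdmx_mxpowR.
  apply: (powR_interp (sigE p p_ge0) (sigE p0 p0_ge0) (sigE p1 p1_ge0)).
  1-3: exact: psd_ge0.
    by rewrite invr_ge0.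
  have -> : 2 * p = (1 - alpha) * (2 * p0) + alpha * (2 * p1).
    by rewrite /p; lra.
  apply: (@topprod_maps_log_convex R n n n k idfun idfun) => //.
  - by rewrite mulr_ge0.
  - by rewrite mulr_ge0.
(* For the equality of full products, [a] and [b] are the determinants of [A] and [B]; both sides
   reduce to the product of their powers with exponent [p], also when one of them is zero, because
   the exponents that are added are nonnegative. *)
pose a := \prod_i rspec A 0 i; pose b := \prod_i rspec B 0 i.
have rhsE (d e : 'rV[R]_n) :
    \prod_i vmul d e 0 i = \prod_i d 0 i * \prod_i e 0 i.
  by rewrite -big_split; apply: eq_bigr => i _; rewrite mxE.
have sigE q : \prod_i sig q 0 i = a `^ q * b `^ q.
  exact: prod_singvals_mxpowR.
have powE q r : \prod_i vpowR (sig q) r 0 i = a `^ (q * r) * b `^ (q * r).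
  rewrite !powRrM -powRM ?powR_ge0 // -[X in X `^ r]sigE.
  rewrite powR_prod => [|i]; last exact: singvals_ge0.
  by apply: eq_bigr => i _; rewrite mxE.
apply: etrans (sigE p) _; apply: esym; apply: etrans (rhsE _ _) _.
apply: etrans (congr2 *%R (powE p0 (1 - alpha)) (powE p1 alpha)) _.
rewrite mulrACA.
rewrite -!powRD_ge0 ?mulr_ge0 //; try lra.
by rewrite [p0 * _]mulrC [p1 * _]mulrC.
Qed.
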